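(* There exists a two-dimensional cellular automaton $\mathcal{A}=(2,Q,\mathcal{N}_{vN},\delta)$ with $\{0,1\}\subseteq Q$, working on the von Neumann neighborhood $\mathcal{N}_{vN}=\{c\in\mathbb{Z}^2 : \|c\|_1\le 1\}$, together with a quiescent state $q_0\in Q\setminus\{0,1\}$ and a set of accepting states $Q_a\subseteq Q$, that recognizes the picture language $L_{\text{L-convex}}$ in real time. That is, for all $n,m$ and every $(n,m)$-picture $p$ over $\{0,1\}$, $$\mathcal{A}^{\,n+m-2}(\mathcal{C}_{p,q_0})(0,0)\in Q_a \iff p\in L_{\text{L-convex}}.$$
   Context: A 2D cellular automaton $(2,Q,\mathcal{N},\delta)$ consists of a finite state set $Q$, a finite neighborhood $\mathcal{N}\subset\mathbb{Z}^2$, and a local rule $\delta:Q^{\mathcal{N}}\to Q$. A configuration is a map $\mathcal{C}:\mathbb{Z}^2\to Q$. The global map is $\mathcal{A}(\mathcal{C})(c)=\delta(n\mapsto \mathcal{C}(c+n))$, and $\mathcal{A}^t$ denotes its $t$-fold iterate. An $(n,m)$-picture over an alphabet $\Sigma$ is a map $p:\{0,\dots,n-1\}\times\{0,\dots,m-1\}\to\Sigma$, so $n$ is the width and $m$ the height. Its picture configuration $\mathcal{C}_{p,q_0}$ is defined by $\mathcal{C}_{p,q_0}(x,y)=p(x,y)$ when $(x,y)$ lies in the picture's domain, and $q_0$ otherwise. In particular the origin $(0,0)$ is the lower-left cell of the picture. For the von Neumann neighborhood, the real time function is $\tau(n,m)=n+m-2$. A (placed) polyomino is a finite 4-connected subset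 of $\mathbb{Z}^2$, considered up to translation. - It is HV-convex if, whenever two of its cells lie on the same row (respectively column), every cell between them on that row (respectively column) also belongs to it. - It is L-convex if it is HV-convex and, for all $(x_1,y_1),(x_2,y_2)$ in the polyomino, at least one of $(x_1,y_2)$ or $(x_2,y_1)$ is in the polyomino. Equivalently, any two of its cells are joined by an inner 4-connected path that changes direction at most once. The picture associated with a polyomino is the picture over $\{0,1\}$ whose dimensions are those of the polyomino's minimal bounding rectangle. A cell has value $1$ if the corresponding cell belongs to the polyomino and $0$ otherwise. $L_{\text{L-convex}}$ is the set of all pictures associated with L-convex polyominoes. *)

(* Defs.v *)
From mathcomp Require Import all_boot.
From Stdlib Require Import ZArith Relation_Operators.

Set Implicit Arguments.
Unset Strict Implicit.
Unset Printing Implicit Defensive.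

Local Open Scope Z_scope.

Definition cell := (Z * Z)%type.

Definition vN := { c : cell | Z.abs c.1 + Z.abs c.2 <= 1 }.

Definition config (Q : Type) := cell -> Q.

Definition global_map (Q : Type) (delta : (vN -> Q) -> Q) (C : config Q) : config Q :=
  fun c => delta (fun nb : vN => C (c.1 + (proj1_sig nb).1, c.2 + (proj1_sig nb).2)).

Definition global_iter (Q : Type) (delta : (vN -> Q) -> Q) (t : nat) (C : config Q)
  : config Q := Nat.iter t (global_map delta) C.

Definition quiescent (Q : Type) (delta : (vN -> Q) -> Q) (q0 : Q) : Prop :=
  delta (fun _ => q0) = q0.

(** An (n,m)-picture over {0,1} is represented by p : nat -> nat -> bool, of which
    only the values p x y with x < n, y < m are relevant.  The symbol 0 is
    [false], 1 is [true]; [emb] embeds {0,1} into the state set Q. *)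
Definition pic_config (Q : Type) (emb : bool -> Q) (q0 : Q)
  (n m : nat) (p : nat -> nat -> bool) : config Q :=
  fun c =>
    if ((0 <=? c.1) && (c.1 <? Z.of_nat n) && (0 <=? c.2) && (c.2 <? Z.of_nat m))%bool
    then emb (p (Z.to_nat c.1) (Z.to_nat c.2))
    else q0.

Definition adj4 (u v : cell) : Prop := Z.abs (u.1 - v.1) + Z.abs (u.2 - v.2) = 1.

Definition finite_cells (P : cell -> Prop) : Prop :=
  exists B : Z, forall c, P c -> Z.abs c.1 <= B /\ Z.abs c.2 <= B.

Definition connected4 (P : cell -> Prop) : Prop :=
  forall u v, P u -> P v ->
    clos_refl_trans cell (fun a b => P a /\ P b /\ adj4 a b) u v.

Definition polyomino (P : cell -> Prop) : Prop := finite_cells P /\ connected4 P.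

Definition HV_convex (P : cell -> Prop) : Prop :=
  (forall x y1 y2 y, P (x, y1) -> P (x, y2) -> y1 <= y <= y2 -> P (x, y)) /\
  (forall y x1 x2 x, P (x1, y) -> P (x2, y) -> x1 <= x <= x2 -> P (x, y)).

Definition L_convex (P : cell -> Prop) : Prop :=
  HV_convex P /\
  (forall x1 y1 x2 y2, P (x1, y1) -> P (x2, y2) -> P (x1, y2) \/ P (x2, y1)).

(** [p] (an (n,m)-picture) is the picture associated with the polyomino P:
    P's minimal bounding rectangle is [a, a+n) x [b, b+m) for some a b, and
    p x y = 1 iff (a+x, b+y) belongs to P. *)
Definition assoc_picture (P : cell -> Prop) (n m : nat) (p : nat -> nat -> bool) : Prop :=
  exists a b : Z,
    (forall c, P c -> a <= c.1 < a + Z.of_nat n /\ b <= c.2 < b + Z.of_nat m) /\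
    (exists y, P (a, y)) /\ (exists y, P (a + Z.of_nat n - 1, y)) /\
    (exists x, P (x, b)) /\ (exists x, P (x, b + Z.of_nat m - 1)) /\
    (forall x y : nat, (x < n)%nat -> (y < m)%nat ->
       (p x y = true <-> P (a + Z.of_nat x, b + Z.of_nat y))).

Definition in_L_Lconvex (n m : nat) (p : nat -> nat -> bool) : Prop :=
  exists P : cell -> Prop, polyomino P /\ L_convex P /\ assoc_picture P n m p.

Definition origin : cell := (0, 0).

(* Main.v *)
Require Import Defs.
From Stdlib Require Import ZArith Relation_Operators.
From HB Require Import structures.
From mathcomp Require Import zify.
From mathcomp Require Import all_boot.

Set Implicit Arguments.
Unset Strict Implicit.
Unset Printing Implicit Defensive.

(** The automaton only reads a cell, its east and its north neighbour.

    An HV-convex picture is L-convex iff the intervals [[l_y, r_y]] of its rows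
    are pairwise comparable for inclusion, and then it has a full row and a full
    column.  To compare right ends, the cell [(r_y, y)] emits a signal westwards
    at time [m - y], when it is reached by a wave coming down from the top side:
    the signal passes [(x, y)] at time [m - y + r_y - x].  Information coming
    straight down from row [y2] to a cell [(x, y1)] thus carries the arrival time
    [m - y1 + r_y2 - x], to be compared with the local one [m - y1 + r_y1 - x].
    Performing the comparison at [x = max(l_y1, l_y2) - 1] makes the comparison of
    left ends local, and a conflict is seen when the earlier of the two signals
    passes; as the smaller right end is at most [n - 2], the conflict is reported
    to the origin by time [n + m - 2].

    Full rows and columns need no knowledge of the borders: at time [t] the origin
    computes whether for some [y] the cells [(0, y), ..., (t - y, y)] of the
    picture are all 1, and at time [n + m - 2] all these segments are whole rows. *)

(** * States and local rule *)

Record state := State {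
  sym : bool; top : bool; right_sig : bool; late_above : bool; early_above : bool;
  one_east : bool; one_north : bool; run_east : bool; run_north : bool;
  full_row : bool; full_col : bool; alarm : bool }.

Definition state_code (s : state) :=
  ((sym s, top s, right_sig s, late_above s, early_above s, one_east s),
   (one_north s, run_east s, run_north s, full_row s, full_col s, alarm s)).

Definition state_decode c :=
  let: ((a, b, c, d, e, f), (g, h, i, j, k, l)) := c in
  State a b c d e f g h i j k l.

Lemma state_codeK : cancel state_code state_decode.
Proof. by case. Qed.

HB.instance Definition _ := Finite.copy state (can_type state_codeK).

Definition init (b : bool) : state :=
  State b false false false false false false b b b b false.

(* In order: a gap in a row, a gap in a column, and a row [y1] incomparable with a
   higher row [y2], with [l_y1 < l_y2] and [r_y1 < r_y2], or the reverse. *)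
Definition local_alarm (east_sym north_sym : bool) (s : state) : bool :=
  [|| [&& sym s, ~~ east_sym & one_east s],
      [&& sym s, ~~ north_sym & one_north s],
      [&& sym s, right_sig s & late_above s]
    | [&& ~~ sym s, east_sym, ~~ right_sig s & early_above s]].

(** A missing neighbour counts as 0 for symbols and signals, but as [true] for [top], which starts
    the wave at the border, and for the runs, which may end there. The local test sees the updated
    flags; the [false] in [s' false] is a placeholder that it never reads. *)
Definition step (s : state) (e u : option state) : state :=
  let b := sym s in
  let eb := oapp sym false e in
  let ub := oapp sym false u in
  let tp := oapp top true u in
  let rs := [&& b, ~~ eb & tp] || oapp right_sig false e in
  let re := b && oapp run_east true e in
  let rn := b && oapp run_north true u in
  let s' a := State b tp rs
    ([&& ~~ b, eb & ~~ rs] || oapp late_above false u)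
    ((b && rs) || oapp early_above false u)
    (eb || oapp one_east false e) (ub || oapp one_north false u) re rn
    (re || oapp full_row false u) (rn || oapp full_col false e) a in
  s' [|| local_alarm eb ub (s' false), alarm s, oapp alarm false e
       | oapp alarm false u].

Definition center_vN : vN. Proof. by exists (0, 0)%Z. Defined.
Definition east_vN : vN. Proof. by exists (1, 0)%Z. Defined.
Definition north_vN : vN. Proof. by exists (0, 1)%Z. Defined.

Definition rule (f : vN -> option state) : option state :=
  if f center_vN is Some s then Some (step s (f east_vN) (f north_vN)) else None.

(** * Meaning of each state component at time [t] *)

Section Run.

Variables (n m : nat) (p : nat -> nat -> bool).

Fixpoint run (t x y : nat) : state :=
  if t is t'.+1 then
    step (run t' x y) (if x.+1 < n then Some (run t' x.+1 y) else None)
                      (if y.+1 < m then Some (run t' x y.+1) else None)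
  else init (p x y).

(** [None] is never left nor entered, so the border stays visible and the evolution reduces to [run]
    on natural coordinates. *)
Lemma global_iterE t (c : cell) :
  global_iter rule t (pic_config (fun b => Some (init b)) None n m p) c =
  if ((0 <=? c.1) && (c.1 <? Z.of_nat n) && (0 <=? c.2) && (c.2 <? Z.of_nat m))%Z
  then Some (run t (Z.to_nat c.1) (Z.to_nat c.2)) else None.
Proof.
elim: t c => [//|t IH] [x y].
rewrite /global_iter /= -/(global_iter rule t _) /global_map /rule !IH /= !Z.add_0_r.
case: ifP => // /andP[/andP[/andP[x0 xn] y0] ym].
have -> : Z.to_nat (x + 1) = (Z.to_nat x).+1 by lia.
have -> : Z.to_nat (y + 1) = (Z.to_nat y).+1 by lia.
do 2 f_equal; congr (if _ then _ else _); lia.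
Qed.

(* The picture extended by 0 outside of its domain. *)
Definition pic x y := [&& x < n, y < m & p x y].

Lemma run_sym t x y : sym (run t x y) = p x y.
Proof. by elim: t x y => //=. Qed.

Lemma sym_east t x y : y < m ->
  oapp sym false (if x.+1 < n then Some (run t x.+1 y) else None) = pic x.+1 y.
Proof. by move=> ym; rewrite /pic ym; case: ifP => //= _; rewrite run_sym. Qed.

Lemma sym_north t x y : x < n ->
  oapp sym false (if y.+1 < m then Some (run t x y.+1) else None) = pic x y.+1.
Proof. by move=> xn; rewrite /pic xn; case: ifP => //= _; rewrite run_sym. Qed.

Lemma run_top t x y : y < m -> top (run t x y) = (m <= t + y).
Proof.
elim: t x y => [|t IH] x y ym /=; first by lia.
by case: ifP => /= h; rewrite ?IH //; lia.
Qed.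

(** The time condition is an inequality because an emitter stays on once the wave has reached it:
    signals are latched, and absence means not yet arrived. *)
Lemma run_right_sigP t x y : x < n -> y < m ->
  right_sig (run t x y) <->
  exists k, [&& pic (x + k) y, ~~ pic (x + k).+1 y & m + k <= t + y].
Proof.
elim: t x y => [|t IH] x y xn ym /=.
  by split=> // -[k]; lia.
rewrite sym_east // run_sym.
have -> : oapp top true (if y.+1 < m then Some (run t x y.+1) else None) =
   (m <= t.+1 + y).
  by case: ifP => /= h; rewrite ?run_top; lia.
have -> : p x y = pic x y by rewrite /pic xn ym.
split=> [/orP[/and3P[h1 h2 h3]|]|[[|k]]].
- by exists 0; rewrite !addn0 h1 h2.
- case: ifP => //= x1n /(IH _ _ x1n ym)[k hk].
  by exists k.+1; rewrite -!addSnnS; move: hk; rewrite -!andbA; lia.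
- by rewrite !addn0 => ->.
- rewrite -!addSnnS => /and3P[h1 h2 h3].
  have x1n : x.+1 < n by move: h1; rewrite /pic; lia.
  rewrite x1n /=; apply/orP; right; apply/(IH _ _ x1n ym); exists k.
  by rewrite h1 h2; lia.
Qed.

Lemma run_one_eastP t x y : x < n -> y < m ->
  one_east (run t x y) <-> exists k, (0 < k <= t) && pic (x + k) y.
Proof.
elim: t x y => [|t IH] x y xn ym /=; first by split=> // -[k]; lia.
rewrite sym_east //; split=> [/orP[h|]|[[//|[|k]]]].
- by exists 1; rewrite addn1.
- case: ifP => //= x1n /(IH _ _ x1n ym)[k hk].
  by exists k.+1; rewrite -addSnnS; lia.
- by rewrite addn1 => /= ->.
- rewrite -addSnnS => /andP[kt h].
  have x1n : x.+1 < n by move: h; rewrite /pic; lia.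
  rewrite x1n /=; apply/orP; right; apply/(IH _ _ x1n ym); exists k.+1.
  by rewrite h andbT; lia.
Qed.

Lemma run_one_northP t x y : x < n -> y < m ->
  one_north (run t x y) <-> exists k, (0 < k <= t) && pic x (y + k).
Proof.
elim: t x y => [|t IH] x y xn ym /=; first by split=> // -[k]; lia.
rewrite sym_north //; split=> [/orP[h|]|[[//|[|k]]]].
- by exists 1; rewrite addn1.
- case: ifP => //= y1m /(IH _ _ xn y1m)[k hk].
  by exists k.+1; rewrite -addSnnS; lia.
- by rewrite addn1 => /= ->.
- rewrite -addSnnS => /andP[kt h].
  have y1m : y.+1 < m by move: h; rewrite /pic; lia.
  rewrite y1m /=; apply/orP; right; apply/(IH _ _ xn y1m); exists k.+1.
  by rewrite h andbT; lia.
Qed.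

(** The descent from row [y + k] takes [k] steps, exactly the delay of the wave between the two
    rows. Both rows are thus tested against the same threshold on [t + y]. *)
Lemma run_late_aboveP t x y : x < n -> y < m ->
  late_above (run t x y) <->
  exists k, [&& k < t, y + k < m, ~~ pic x (y + k), pic x.+1 (y + k)
              & ~~ right_sig (run (t - k) x (y + k))].
Proof.
elim: t x y => [|t IH] x y xn ym; first by split=> // -[k]; lia.
have -> : late_above (run t.+1 x y) =
   [&& ~~ pic x y, pic x.+1 y & ~~ right_sig (run t.+1 x y)] ||
   oapp late_above false (if y.+1 < m then Some (run t x y.+1) else None).
  by rewrite -(sym_east t) // /pic xn ym -(run_sym t).
split=> [/orP[h|]|[[|k]]].
- by exists 0; rewrite subn0 !addn0 ym.
- case: ifP => //= y1m /(IH _ _ xn y1m)[k hk].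
  by exists k.+1; rewrite -addSnnS subSS ltnS.
- by rewrite subn0 !addn0 => /and5P[_ _ -> -> ->].
- rewrite -addSnnS subSS ltnS => h.
  have y1m : y.+1 < m by lia.
  by rewrite y1m /=; apply/orP; right; apply/(IH _ _ xn y1m); exists k.
Qed.

Lemma run_early_aboveP t x y : x < n -> y < m ->
  early_above (run t x y) <->
  exists k, [&& k < t, pic x (y + k) & right_sig (run (t - k) x (y + k))].
Proof.
elim: t x y => [|t IH] x y xn ym; first by split=> // -[k]; lia.
have -> : early_above (run t.+1 x y) = (pic x y && right_sig (run t.+1 x y)) ||
   oapp early_above false (if y.+1 < m then Some (run t x y.+1) else None).
  by rewrite /pic xn ym -(run_sym t).
split=> [/orP[h|]|[[|k]]].
- by exists 0; rewrite subn0 !addn0.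
- case: ifP => //= y1m /(IH _ _ xn y1m)[k hk].
  by exists k.+1; rewrite -addSnnS subSS ltnS.
- by rewrite subn0 !addn0 => /and3P[_ -> ->].
- rewrite -addSnnS subSS ltnS => h.
  have y1m : y.+1 < m by move: h; rewrite /pic; lia.
  by rewrite y1m /=; apply/orP; right; apply/(IH _ _ xn y1m); exists k.
Qed.

Lemma run_run_eastP t x y : x < n -> y < m ->
  run_east (run t x y) <-> forall k, k <= t -> x + k < n -> pic (x + k) y.
Proof.
elim: t x y => [|t IH] x y xn ym /=.
  split=> [h [|//] _ _|h]; first by rewrite addn0 /pic xn ym.
  by move: (h 0 isT); rewrite addn0 /pic xn ym; apply.
rewrite run_sym; split=> [/andP[h] + [|k]|h].
- by rewrite addn0 /pic xn ym.
- rewrite -addSnnS ltnS => + kt xkn.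
  have x1n : x.+1 < n by lia.
  by rewrite x1n => /= /(IH _ _ x1n ym); apply.
- apply/andP; split.
    by move: (h 0 isT); rewrite addn0 /pic xn ym; apply.
  case: ifP => //= x1n; apply/(IH _ _ x1n ym) => k kt.
  by rewrite addSnnS; apply: h.
Qed.

Lemma run_run_northP t x y : x < n -> y < m ->
  run_north (run t x y) <-> forall k, k <= t -> y + k < m -> pic x (y + k).
Proof.
elim: t x y => [|t IH] x y xn ym /=.
  split=> [h [|//] _ _|h]; first by rewrite addn0 /pic xn ym.
  by move: (h 0 isT); rewrite addn0 /pic xn ym; apply.
rewrite run_sym; split=> [/andP[h] + [|k]|h].
- by rewrite addn0 /pic xn ym.
- rewrite -addSnnS ltnS => + kt ykm.
  have y1m : y.+1 < m by lia.
  by rewrite y1m => /= /(IH _ _ xn y1m); apply.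
- apply/andP; split.
    by move: (h 0 isT); rewrite addn0 /pic xn ym; apply.
  case: ifP => //= y1m; apply/(IH _ _ xn y1m) => k kt.
  by rewrite addSnnS; apply: h.
Qed.

Lemma run_full_rowP t x y : x < n -> y < m ->
  full_row (run t x y) <->
  exists k, [&& k <= t, y + k < m & run_east (run (t - k) x (y + k))].
Proof.
elim: t x y => [|t IH] x y xn ym.
  split=> [h|[[|//]]]; first by exists 0; rewrite !addn0 ym.
  by rewrite !addn0 ym.
have -> : full_row (run t.+1 x y) = run_east (run t.+1 x y) ||
   oapp full_row false (if y.+1 < m then Some (run t x y.+1) else None) by [].
split=> [/orP[h|]|[[|k]]].
- by exists 0; rewrite subn0 !addn0 ym.
- case: ifP => //= y1m /(IH _ _ xn y1m)[k hk].
  by exists k.+1; rewrite -addSnnS subSS ltnS.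
- by rewrite subn0 !addn0 => /and3P[_ _ ->].
- rewrite -addSnnS subSS ltnS => h.
  have y1m : y.+1 < m by lia.
  by rewrite y1m /=; apply/orP; right; apply/(IH _ _ xn y1m); exists k.
Qed.

Lemma run_full_colP t x y : x < n -> y < m ->
  full_col (run t x y) <->
  exists k, [&& k <= t, x + k < n & run_north (run (t - k) (x + k) y)].
Proof.
elim: t x y => [|t IH] x y xn ym.
  split=> [h|[[|//]]]; first by exists 0; rewrite !addn0 xn.
  by rewrite !addn0 xn.
have -> : full_col (run t.+1 x y) = run_north (run t.+1 x y) ||
   oapp full_col false (if x.+1 < n then Some (run t x.+1 y) else None) by [].
split=> [/orP[h|]|[[|k]]].
- by exists 0; rewrite subn0 !addn0 xn.
- case: ifP => //= x1n /(IH _ _ x1n ym)[k hk].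
  by exists k.+1; rewrite -addSnnS subSS ltnS.
- by rewrite subn0 !addn0 => /and3P[_ _ ->].
- rewrite -addSnnS subSS ltnS => h.
  have x1n : x.+1 < n by lia.
  by rewrite x1n /=; apply/orP; right; apply/(IH _ _ x1n ym); exists k.
Qed.

Definition alarm_at t x y := local_alarm (pic x.+1 y) (pic x y.+1) (run t x y).

Lemma run_alarmS t x y : x < n -> y < m ->
  alarm (run t.+1 x y) =
  [|| alarm_at t.+1 x y, alarm (run t x y),
      oapp alarm false (if x.+1 < n then Some (run t x.+1 y) else None)
    | oapp alarm false (if y.+1 < m then Some (run t x y.+1) else None)].
Proof.
by move=> xn ym; rewrite /alarm_at -(sym_east t) // -(sym_north t).
Qed.

(** Alarms persist and spread west and south by one cell per step, so [i + j] is the travel time. *)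
Lemma run_alarmP t x y : x < n -> y < m ->
  alarm (run t x y) <->
  exists i j s, [&& x + i < n, y + j < m, s + i + j <= t
                  & alarm_at s (x + i) (y + j)].
Proof.
have alarm0 x' y' : alarm_at 0 x' y' = false.
  by rewrite /alarm_at /local_alarm /= !andbF.
elim: t x y => [|t IH] x y xn ym.
  split=> // -[i [j [s /and4P[_ _ +]]]].
  by rewrite leqn0 !addn_eq0 => /andP[/andP[/eqP-> _] _]; rewrite alarm0.
rewrite run_alarmS //; split=> [/or4P[h|/(IH _ _ xn ym)|+|+]|].
- by exists 0, 0, t.+1; rewrite !addn0 xn ym leqnn.
- by move=> [i [j [s /and4P[h1 h2 h3 h4]]]]; exists i, j, s; rewrite h1 h2 h4; lia.
- case: ifP => //= x1n /(IH _ _ x1n ym)[i [j [s]]].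
  rewrite addSnnS => /and4P[h1 h2 h3 h4].
  by exists i.+1, j, s; rewrite h1 h2 h4; lia.
- case: ifP => //= y1m /(IH _ _ xn y1m)[i [j [s]]].
  rewrite addSnnS => /and4P[h1 h2 h3 h4].
  by exists i, j.+1, s; rewrite h1 h2 h4; lia.
move=> [[|i] [j [s /and4P[h1 h2 h3 h4]]]]; last first.
  have x1n : x.+1 < n by lia.
  apply/or4P/Or43; rewrite x1n /=; apply/(IH _ _ x1n ym); exists i, j, s.
  by rewrite addSnnS h1 h2 h4; lia.
case: j => [|j] in h2 h3 h4 *; last first.
  have y1m : y.+1 < m by lia.
  apply/or4P/Or44; rewrite y1m /=; apply/(IH _ _ xn y1m); exists 0, j, s.
  by rewrite addSnnS h1 h2 h4; lia.
move: h3; rewrite !addn0 leq_eqVlt => /orP[/eqP h3|h3].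
  by apply/or4P/Or41; move: h4; rewrite h3 !addn0.
apply/or4P/Or42/(IH _ _ xn ym); exists 0, 0, s.
by rewrite h1 h2 h4; lia.
Qed.

(** * Acceptance at real time characterizes L-convex pictures *)

Definition row_convex := forall x1 x x2 y,
  x1 <= x -> x <= x2 -> pic x1 y -> pic x2 y -> pic x y.
Definition col_convex := forall x y1 y y2,
  y1 <= y -> y <= y2 -> pic x y1 -> pic x y2 -> pic x y.
Definition corner_closed := forall x1 y1 x2 y2,
  pic x1 y1 -> pic x2 y2 -> pic x1 y2 \/ pic x2 y1.
Definition has_full_row := exists2 y, y < m & forall x, x < n -> pic x y.
Definition has_full_col := exists2 x, x < n & forall y, y < m -> pic x y.

(** The full row and full column express that the bounding rectangle is minimal, in a form that the
    automaton can test. *)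
Definition Lconvex_pic :=
  [/\ row_convex, col_convex, corner_closed, has_full_row & has_full_col].

Definition accepting (s : state) := [&& full_row s, full_col s & ~~ alarm s].

Lemma pic_bounds x y : pic x y -> x < n /\ y < m.
Proof. by case/and3P. Qed.

Lemma last_true (q : pred nat) a b : a <= b -> q a -> ~~ q b ->
  exists r, [&& a <= r, r < b, q r & ~~ q r.+1].
Proof.
elim: b => [|b IH]; first by case: a => // _ ->.
rewrite leq_eqVlt => /orP[/eqP<- ->//|]; rewrite ltnS => ab qa qb.
have [qb'|qb'] := boolP (q b); first by exists b; rewrite ab leqnn qb' qb.
by have [r /and4P[h1 h2 h3 h4]] := IH ab qa qb'; exists r; rewrite h1 h3 h4; lia.
Qed.

Lemma row_end x y : pic x y ->
  exists r, [&& x <= r, r < n, pic r y & ~~ pic r.+1 y].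
Proof.
move=> h; have [xn _] := pic_bounds h.
by apply: (@last_true (pic^~ y)) => //; [exact: ltnW | rewrite /pic ltnn].
Qed.

Lemma has_full_rowP : 0 < n -> 0 < m ->
  full_row (run (n + m - 2) 0 0) <-> has_full_row.
Proof.
move=> n0 m0; rewrite run_full_rowP //; split=> [[k /and3P[h1 h2]]|[y ym h]].
  move=> /(run_run_eastP _ n0 h2) h; exists k => // x xn.
  (* Since [k <= m - 1], the segment read in row [k] has length bound [n + m - 2 - k >= n - 1] and
     reaches the east side. *)
  by apply: (h x) => //; lia.
exists y; apply/and3P; split; rewrite ?add0n //; first by lia.
by apply/run_run_eastP => // k _; apply: h.
Qed.

Lemma has_full_colP : 0 < n -> 0 < m ->
  full_col (run (n + m - 2) 0 0) <-> has_full_col.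
Proof.
move=> n0 m0; rewrite run_full_colP //; split=> [[k /and3P[h1 h2]]|[x xn h]].
  move=> /(run_run_northP _ h2 m0) h; exists k => // y ym.
  by apply: (h y) => //; lia.
exists x; apply/and3P; split; rewrite ?add0n //; first by lia.
by apply/run_run_northP => // k _; apply: h.
Qed.

(** The first two tests contradict convexity. In the last two, signal times order the right ends of
    the two rows, left ends are ordered the same way, and the corner condition fails. *)
Lemma Lconvex_no_alarm t x y : row_convex -> col_convex -> corner_closed ->
  x < n -> y < m -> ~~ alarm_at t x y.
Proof.
move=> rc cc lc xn ym; rewrite /alarm_at /local_alarm run_sym.
have -> : p x y = pic x y by rewrite /pic xn ym.
apply/negP => /or4P[] /and3P[h1 h2].
- move=> /(run_one_eastP _ xn ym)[k /andP[k0 hk]].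
  by move/negP: h2; apply; apply: (rc x _ (x + k)) => //; lia.
- move=> /(run_one_northP _ xn ym)[k /andP[k0 hk]].
  by move/negP: h2; apply; apply: (cc _ y _ (y + k)) => //; lia.
- move=> /(run_late_aboveP _ xn ym)[k /and5P[kt ykm h3 h4 /negP h5]].
  have [r /and4P[r1 rn r2 r3]] := row_end h4.
  case/(run_right_sigP _ xn ym): h2 => j /and3P[j1 j2 j3].
  (* Otherwise the signal from [r] would have passed column [x] of the upper row by time [t - k]. *)
  have jr : x + j < r.
    rewrite ltnNge; apply/negP => rj; apply: h5.
    apply/(run_right_sigP _ xn ykm); exists (r - x).
    by rewrite subnKC ?r2 ?r3; lia.
  case: (lc _ _ _ _ h1 r2); first by apply/negP.
  by move=> h; move/negP: j2; apply; apply: (rc (x + j) _ r) => //; lia.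
- move=> /andP[/negP h3 /(run_early_aboveP _ xn ym)[k /and3P[kt h4]]].
  have [_ ykm] := pic_bounds h4.
  move=> /(run_right_sigP _ xn ykm)[j /and3P[j1 j2 j3]].
  have [r /and4P[r1 rn r2 r3]] := row_end h2.
  have jr : x + j < r.
    rewrite ltnNge; apply/negP => rj; apply: h3.
    apply/(run_right_sigP _ xn ym); exists (r - x).
    by rewrite subnKC ?r2 ?r3; lia.
  case: (lc _ _ _ _ r2 h4); last by apply/negP.
  by move=> h; move/negP: j2; apply; apply: (rc (x + j) _ r) => //; lia.
Qed.

Section NoAlarm.

Hypothesis silent : forall x y t,
  x < n -> y < m -> t + x + y <= n + m - 2 -> ~~ alarm_at t x y.

Lemma silent_row_convex : row_convex.
Proof.
move=> x1 x x2 y le1 le2 h1 h2; apply: contraT => hx.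
have [r /and4P[r1 r2 r3 r4]] := last_true (q := pic^~ y) le1 h1 hx.
have [[rn ym] [x2n _]] := (pic_bounds r3, pic_bounds h2).
(* The 1 at [x2] is known at [r] after [x2 - r] steps; the alarm then reaches the origin at time
   [x2 + y], at most [n + m - 2]. *)
have /negP[] : ~~ alarm_at (x2 - r) r y by apply: silent => //; lia.
rewrite /alarm_at /local_alarm run_sym r4; apply/or4P/Or41.
move: (r3); rewrite {1}/pic rn ym /= => -> /=.
apply/run_one_eastP => //; exists (x2 - r).
by rewrite subnKC ?h2; lia.
Qed.

Lemma silent_col_convex : col_convex.
Proof.
move=> x y1 y y2 le1 le2 h1 h2; apply: contraT => hy.
have [r /and4P[r1 r2 r3 r4]] := last_true le1 h1 hy.
have [[xn rm] [_ y2m]] := (pic_bounds r3, pic_bounds h2).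
have /negP[] : ~~ alarm_at (y2 - r) x r by apply: silent => //; lia.
rewrite /alarm_at /local_alarm run_sym r4; apply/or4P/Or42.
move: (r3); rewrite {1}/pic xn rm /= => -> /=.
apply/run_one_northP => //; exists (y2 - r).
by rewrite subnKC ?h2; lia.
Qed.

(** By row convexity no run ends between [x] and [z], so a signal must come from distance at least
    [z - x]. *)
Lemma no_right_sig t x y z : row_convex -> pic z y -> x < n ->
  t + y < m + (z - x) -> ~~ right_sig (run t x y).
Proof.
move=> rc h xn lt; have [_ ym] := pic_bounds h.
apply/negP => /(run_right_sigP _ xn ym)[k /and3P[h1 h2 h3]].
by move/negP: h2; apply; apply: (rc (x + k) _ z) => //; lia.
Qed.

(* Both cases compare the right ends of rows [y1 < y2] in the column just west
   of the larger of the two left ends; the full column makes it meet both rows. *)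
Lemma silent_corner_lt x1 y1 x2 y2 : has_full_col -> y1 < y2 ->
  pic x1 y1 -> pic x2 y2 -> pic x1 y2 \/ pic x2 y1.
Proof.
move=> [c cn hc] y12 h1 h2.
have rc := silent_row_convex.
have [[x1n y1m] [x2n y2m]] := (pic_bounds h1, pic_bounds h2).
have [|n12] := boolP (pic x1 y2); first by left.
have [|n21] := boolP (pic x2 y1); first by right.
have [c1 c2] := (hc _ y1m, hc _ y2m).
exfalso; have [x12|x21|e] := ltngtP x1 x2; last by move: n12; rewrite e h2.
(* Applied to the complement of row [y2], [last_true] yields the column just west of its left
   end. *)
- have [|x /and4P[xa xb xc]] :=
    last_true (q := fun x => ~~ pic x y2) (ltnW x12) n12; first by rewrite negbK.
  rewrite negbK => xd.
  have xltc : x < c.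
    rewrite ltnNge; apply/negP => cx.
    by move/negP: xc; apply; apply: (rc c _ x2) => //; lia.
  have cx2 : c < x2.
    rewrite ltnNge; apply/negP => cx.
    by move/negP: n21; apply; apply: (rc x1 _ c) => //; lia.
  have [r /and4P[r1 r2 r3 r4]] := last_true (q := pic^~ y1) (ltnW cx2) c1 n21.
  have xn : x < n by lia.
  have px : pic x y1 by apply: (rc x1 _ c) => //; lia.
  (* This is when the signal of row [y1] passes [x]. Adding the distance to the origin gives
     [m + r], within real time because [r < x2 <= n - 1]. *)
  have /negP[] : ~~ alarm_at (m - y1 + (r - x)) x y1 by apply: silent => //; lia.
  rewrite /alarm_at /local_alarm run_sym; apply/or4P/Or43.
  move: (px); rewrite {1}/pic xn y1m /= => -> /=.
  apply/andP; split.
    by apply/run_right_sigP => //; exists (r - x); rewrite subnKC ?r3 ?r4; lia.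
  apply/run_late_aboveP => //; exists (y2 - y1).
  rewrite subnKC ?xc ?xd ?y2m; last by lia.
  apply/and5P; split=> //; first by lia.
  by apply: (no_right_sig (z := x2)) => //; lia.
- have [|x /and4P[xa xb xc]] :=
    last_true (q := fun x => ~~ pic x y1) (ltnW x21) n21; first by rewrite negbK.
  rewrite negbK => xd.
  have xltc : x < c.
    rewrite ltnNge; apply/negP => cx.
    by move/negP: xc; apply; apply: (rc c _ x1) => //; lia.
  have cx1 : c < x1.
    rewrite ltnNge; apply/negP => cx.
    by move/negP: n12; apply; apply: (rc x2 _ c) => //; lia.
  have [r /and4P[r1 r2 r3 r4]] := last_true (q := pic^~ y2) (ltnW cx1) c2 n12.
  have xn : x < n by lia.
  have px : pic x y2 by apply: (rc x2 _ c) => //; lia.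
  (* The signal of row [y2] passes [x] at time [m - y2 + (r - x)] and needs [y2 - y1] more steps to
     descend to row [y1]. *)
  have /negP[] : ~~ alarm_at (m - y1 + (r - x)) x y1 by apply: silent => //; lia.
  rewrite /alarm_at /local_alarm run_sym xd; apply/or4P/Or44.
  move: (xc); rewrite {1}/pic xn y1m /= => -> /=.
  apply/andP; split; first by apply: (no_right_sig (z := x1)) => //; lia.
  apply/run_early_aboveP => //; exists (y2 - y1).
  rewrite subnKC ?px; last by lia.
  apply/and3P; split=> //; first by lia.
  by apply/run_right_sigP => //; exists (r - x); rewrite subnKC ?r3 ?r4; lia.
Qed.

Lemma silent_corner_closed : has_full_col -> corner_closed.
Proof.
move=> fc x1 y1 x2 y2 h1 h2.
have [lt|gt|e] := ltngtP y1 y2; first exact: silent_corner_lt.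
  by case: (silent_corner_lt fc gt h2 h1); [right | left].
by left; rewrite -e.
Qed.

End NoAlarm.

Lemma run_accepting : 0 < n -> 0 < m ->
  accepting (run (n + m - 2) 0 0) <-> Lconvex_pic.
Proof.
move=> n0 m0; split=> [/and3P[fr fc al]|[rc cc lc fr fc]].
  have silent x y t : x < n -> y < m -> t + x + y <= n + m - 2 ->
      ~~ alarm_at t x y.
    move=> xn ym le; apply: contra al => h; apply/run_alarmP => //.
    by exists x, y, t; rewrite !add0n xn ym le h.
  move/(has_full_colP n0 m0): fc => fc; move/(has_full_rowP n0 m0): fr => fr.
  split=> //; [exact: silent_row_convex | exact: silent_col_convex|].
  exact: silent_corner_closed.
apply/and3P; split; [exact/has_full_rowP | exact/has_full_colP|].
apply/negP => /(run_alarmP _ n0 m0)[i [j [s /and4P[xn ym _]]]].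
by apply/negP; apply: Lconvex_no_alarm.
Qed.

(** * From pictures to polyominoes and back *)

Definition pic_cells (c : cell) : Prop :=
  (0 <= c.1)%Z /\ (0 <= c.2)%Z /\ pic (Z.to_nat c.1) (Z.to_nat c.2).

Lemma pic_cells_nat x y : pic_cells (Z.of_nat x, Z.of_nat y) <-> pic x y.
Proof. by rewrite /pic_cells /= !Nat2Z.id; split=> [[_ []]|]; lia. Qed.

Lemma pic_cellsP (c : cell) : pic_cells c ->
  exists x y, c = (Z.of_nat x, Z.of_nat y) /\ pic x y.
Proof.
case: c => x y [/= h1 [h2 h3]]; exists (Z.to_nat x), (Z.to_nat y).
by rewrite !Z2Nat.id.
Qed.

Local Notation linked := (clos_refl_trans cell
  (fun a b => pic_cells a /\ pic_cells b /\ adj4 a b)).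

Lemma linked_sym u v : linked u v -> linked v u.
Proof.
elim=> [a b [ha [hb]]|a|a b c _ h1 _ h2]; last 2 first.
- exact: rt_refl.
- exact: rt_trans h2 h1.
by rewrite /adj4 => h; apply: rt_step; split=> //; split=> //; rewrite /adj4; lia.
Qed.

Lemma linked_row x k y : (forall i, i <= k -> pic (x + i) y) ->
  linked (Z.of_nat x, Z.of_nat y) (Z.of_nat (x + k), Z.of_nat y).
Proof.
elim: k => [|k IH] h; first by rewrite addn0; exact: rt_refl.
apply: rt_trans (IH _) _ => [i ik|]; first by apply: h; lia.
apply: rt_step; split; [|split]; try by apply/pic_cells_nat; apply: h; lia.
by rewrite /adj4 /=; lia.
Qed.

Lemma linked_col x y k : (forall i, i <= k -> pic x (y + i)) ->
  linked (Z.of_nat x, Z.of_nat y) (Z.of_nat x, Z.of_nat (y + k)).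
Proof.
elim: k => [|k IH] h; first by rewrite addn0; exact: rt_refl.
apply: rt_trans (IH _) _ => [i ik|]; first by apply: h; lia.
apply: rt_step; split; [|split]; try by apply/pic_cells_nat; apply: h; lia.
by rewrite /adj4 /=; lia.
Qed.

Lemma row_convex_linked x1 x2 y : row_convex -> pic x1 y -> pic x2 y ->
  linked (Z.of_nat x1, Z.of_nat y) (Z.of_nat x2, Z.of_nat y).
Proof.
move=> rc; wlog le : x1 x2 / x1 <= x2 => [W h1 h2|h1 h2].
  have [le|/ltnW le] := leqP x1 x2; first exact: W.
  by apply: linked_sym; exact: W.
by rewrite -(subnKC le); apply: linked_row => i ik; apply: (rc x1 _ x2) => //; lia.
Qed.

Lemma col_convex_linked x y1 y2 : col_convex -> pic x y1 -> pic x y2 ->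
  linked (Z.of_nat x, Z.of_nat y1) (Z.of_nat x, Z.of_nat y2).
Proof.
move=> cc; wlog le : y1 y2 / y1 <= y2 => [W h1 h2|h1 h2].
  have [le|/ltnW le] := leqP y1 y2; first exact: W.
  by apply: linked_sym; exact: W.
by rewrite -(subnKC le); apply: linked_col => i ik; apply: (cc _ y1 _ y2) => //; lia.
Qed.

(** Two cells are joined through the corner that [corner_closed] provides, by one straight segment
    in a column and one in a row. *)
Lemma pic_cells_connected : row_convex -> col_convex -> corner_closed ->
  connected4 pic_cells.
Proof.
move=> rc cc lc _ _ /pic_cellsP[x1 [y1 [-> h1]]] /pic_cellsP[x2 [y2 [-> h2]]].
case: (lc _ _ _ _ h1 h2) => h.
  by apply: (rt_trans _ _ _ (Z.of_nat x1, Z.of_nat y2));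
    [exact: col_convex_linked | exact: row_convex_linked].
by apply: (rt_trans _ _ _ (Z.of_nat x2, Z.of_nat y1));
  [exact: row_convex_linked | exact: col_convex_linked].
Qed.

Lemma pic_cells_L_convex : row_convex -> col_convex -> corner_closed ->
  L_convex pic_cells.
Proof.
move=> rc cc lc; split; [split|] => [x y1 y2 y|y x1 x2 x|x1 y1 x2 y2].
- move=> [/= a1 [b1 c1]] [/= a2 [b2 c2]] le; split=> //=; split; first by lia.
  by apply: (cc _ (Z.to_nat y1) _ (Z.to_nat y2)) => //; lia.
- move=> [/= a1 [b1 c1]] [/= a2 [b2 c2]] le; split=> /=; first by lia.
  by split=> //; apply: (rc (Z.to_nat x1) _ (Z.to_nat x2)) => //; lia.
- move=> [/= a1 [b1 c1]] [/= a2 [b2 c2]].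
  by case: (lc _ _ _ _ c1 c2); [left | right].
Qed.

(** The full row meets the west and east sides and the full column the south and north sides, so the
    rectangle placed at the origin is minimal. *)
Lemma Lconvex_pic_in_L : 0 < n -> 0 < m -> Lconvex_pic -> in_L_Lconvex n m p.
Proof.
move=> n0 m0 [rc cc lc [yr yrm fr] [xc xcn fc]].
exists pic_cells; split; [split|split].
- by exists (Z.of_nat (n + m)) => _ /pic_cellsP[x [y [-> /pic_bounds h]]] /=; lia.
- exact: pic_cells_connected.
- exact: pic_cells_L_convex.
exists 0%Z, 0%Z; split; [|split; [|split; [|split; [|split]]]].
- by move=> _ /pic_cellsP[x [y [-> /pic_bounds h]]] /=; lia.
- by exists (Z.of_nat yr); apply/(pic_cells_nat 0)/fr.
- exists (Z.of_nat yr); have -> : (0 + Z.of_nat n - 1 = Z.of_nat n.-1)%Z by lia.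
  by apply/pic_cells_nat/fr; lia.
- by exists (Z.of_nat xc); apply/(pic_cells_nat _ 0)/fc.
- exists (Z.of_nat xc); have -> : (0 + Z.of_nat m - 1 = Z.of_nat m.-1)%Z by lia.
  by apply/pic_cells_nat/fc; lia.
- by move=> x y xn ym; rewrite !Z.add_0_l pic_cells_nat /pic xn ym.
Qed.

(* A row meeting the west side and a row meeting the east side are merged by the
   corner condition into a full row; likewise for columns. *)
Lemma in_L_Lconvex_pic : 0 < n -> 0 < m -> in_L_Lconvex n m p -> Lconvex_pic.
Proof.
move=> n0 m0 [P [_ [[[cv rv] lc]]]].
move=> [a [b [bd [[yl hl] [[yr hr] [[xb hb] [[xt ht] hp]]]]]]].
have picP x y : x < n -> y < m ->
    pic x y <-> P (a + Z.of_nat x, b + Z.of_nat y)%Z.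
  by move=> xn ym; rewrite -hp; [rewrite /pic xn ym | lia | lia].
have picW x y : pic x y -> P (a + Z.of_nat x, b + Z.of_nat y)%Z.
  by move=> h; have [xn ym] := pic_bounds h; apply/picP.
split.
- move=> x1 x x2 y le1 le2 h1 h2; have [x2n ym] := pic_bounds h2.
  apply/picP => //; first by lia.
  by apply: rv (picW _ _ h1) (picW _ _ h2) _; lia.
- move=> x y1 y y2 le1 le2 h1 h2; have [xn y2m] := pic_bounds h2.
  apply/picP => //; first by lia.
  by apply: cv (picW _ _ h1) (picW _ _ h2) _; lia.
- move=> x1 y1 x2 y2 h1 h2.
  have [[x1n y1m] [x2n y2m]] := (pic_bounds h1, pic_bounds h2).
  by case: (lc _ _ _ _ (picW _ _ h1) (picW _ _ h2)) => /picP h; [left|right]; apply: h.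
- have [y [h1 h2]] : exists y, P (a, y) /\ P (a + Z.of_nat n - 1, y)%Z.
    by case: (lc _ _ _ _ hl hr) => h; [exists yr | exists yl].
  have /= [_ hy] := bd _ h1.
  exists (Z.to_nat (y - b)) => [|x xn]; first by lia.
  apply/picP => //; first by lia.
  have -> : (b + Z.of_nat (Z.to_nat (y - b)) = y)%Z by lia.
  by apply: rv h1 h2 _; lia.
- have [x [h1 h2]] : exists x, P (x, b) /\ P (x, b + Z.of_nat m - 1)%Z.
    by case: (lc _ _ _ _ hb ht) => h; [exists xb | exists xt].
  have /= [hx _] := bd _ h1.
  exists (Z.to_nat (x - a)) => [|y ym]; first by lia.
  apply/picP => //; first by lia.
  have -> : (a + Z.of_nat (Z.to_nat (x - a)) = x)%Z by lia.
  by apply: cv h1 h2 _; lia.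
Qed.

End Run.

Theorem theorem1 :
  exists (Q : finType) (emb : bool -> Q) (q0 : Q) (Qa : {set Q})
         (delta : (vN -> Q) -> Q),
    injective emb /\ (forall b, q0 <> emb b) /\ quiescent delta q0 /\
    forall (n m : nat) (p : nat -> nat -> bool), (0 < n)%N -> (0 < m)%N ->
      (global_iter delta (n + m - 2)%N (pic_config emb q0 n m p) origin \in Qa
       <-> in_L_Lconvex n m p).
Proof.
exists (option state : finType), (fun b => Some (init b)), None.
exists [set q | oapp accepting false q], rule.
split; first by move=> b b' [].
split=> //; split=> // n m p n0 m0.
rewrite global_iterE inE /=.
have -> : (0 <? Z.of_nat n)%Z by lia.
have -> : (0 <? Z.of_nat m)%Z by lia.
rewrite run_accepting //; split; first exact: Lconvex_pic_in_L.
exact: in_L_Lconvex_pic.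
Qed.
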